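(* Let $G$ be the automorphism group of $H^2(Cay)$, let $K$ be the stabilizer of $(0,0)$ in $G$, let $A=\{a_t:t\in\mathbb{R}\}\subset G$, and let $M$ be the commutant (centralizer) of $A$ in $K$. Then $M=Stab_K(1,0)$, the stabilizer in $K$ of the point $(1,0)$.
   Context: **Octonions.** $Cay$ is the 8-dimensional non-associative (alternative) real division algebra with basis $e_0=1,e_1,\dots,e_7$ and relations: $e_0e_i=e_ie_0=e_i$ for all $i$; $e_i^2=-e_0$ for $i>0$; $e_ie_j=-e_je_i$ for $i,j>0$, $i\ne j$; $e_2e_6=e_3e_4=e_5e_7=e_1$ together with all relations deduced from these by cyclic permutations of the indices $1,2,\dots,7$. For $x=a+\sum_{i=1}^7 b_ie_i$: conjugate $\overline{x}=a-\sum_{i=1}^7 b_ie_i$, norm $N(x)=x\overline{x}=a^2+\sum b_i^2$, modulus $|x|=\sqrt{N(x)}$, inverse $x^{-1}=\overline{x}/N(x)$ for $x\neq 0$. Real numbers are identified with multiples of $1$. **Projective plane.** $P^2(Cay)$ is the disjoint union of $Cay\times Cay$ (points at finite distance) and the set of points at infinity $\{(u):u\in Cay\cup\{\infty\}\}$. Its lines are: $[u,v]=\{(x,y)\in Cay\times Cay:y=ux+v\}\cup\{(u)\}$ for $u,v\in Cay$; $[u]=\{(x,y)\in Cay\times Cay:x=u\}\cup\{(\infty)\}$ for $u\in Cay$; and $[\infty]$, the set of all points at infinity. A collineation is a bijection of $P^2(Cay)$ onto itself preserving the set of lines. **Polarity and hyperbolic plane.** A polarity is a bijection $\Pi$ from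 points to lines such that, if $a$ runs through a line, then $\Pi(a)$ runs in the sheaf of lines through a given point, and $a\in\Pi(b)\Leftrightarrow b\in\Pi(a)$; it acts on lines by sending a line $L$ to the common point of the lines $\Pi(a)$, $a\in L$. Let $\Pi$ be the polarity of $P^2(Cay)$ given by $\Pi(x,y)=[-\overline{xy^{-1}},\overline{y^{-1}}]$ if $y\ne0$, $\Pi(x,0)=[\overline{x^{-1}}]$ if $x\neq0$, $\Pi(0,0)=[\infty]$ (its values at points at infinity are then forced: $\Pi((\infty))=[0,0]$, $\Pi((0))=[0]$, $\Pi((u))=[-\overline{u^{-1}},0]$ for $u\in Cay\setminus\{0\}$). The hyperbolic plane is $H^2(Cay)=\{(x_1,x_2)\in Cay\times Cay:|x_1|^2+|x_2|^2<1\}$. Its automorphism group $G$ is the group of collineations of $P^2(Cay)$ commuting with $\Pi$; it is a simple Lie group isomorphic to $F_{4(-20)}$, it acts on $H^2(Cay)$, and it preserves the boundary sphere $|x_1|^2+|x_2|^2=1$, which contains the point $(1,0)\in Cay\times Cay$. **The group $A$.** For $t\in\mathbb{R}$, $a_t\in G$ is the element acting on $H^2(Cay)$ by $$a_t(x_1,x_2)= \big((\cosh(t)x_1 + \sinh(t))(\sinh(t)x_1+\cosh(t))^{-1},\ x_2(\sinh(t)x_1+\cosh(t))^{-1}\big).$$ $A=\{a_t:t\in\mathbb{R}\}$ is the split one-parameter group in an Iwasawa decomposition $G=KAN$; the minimal parabolic subgroup of $G$ is $P=MAN$. *)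

(* Defs.v *)
From mathcomp Require Import all_boot all_order all_algebra.
From mathcomp Require Import boolp classical_sets reals sequences exp.

Set Implicit Arguments.
Unset Strict Implicit.
Unset Printing Implicit Defensive.

Import Order.TTheory GRing.Theory Num.Theory.
Local Open Scope classical_set_scope.
Local Open Scope ring_scope.

(* Octonions are row vectors of coordinates in the basis e_0, ..., e_7; only
   the vector space structure of 'rV[R]_8 is used. The norm that analysis puts
   on matrices is the sup norm, hence the separate modulus [oct_abs]. *)
Notation octonion R := 'rV[R]_8.

(* Action of the n-th power of the cycle (1 2 ... 7) on an index i > 0. *)
Definition cyc7 (n i : nat) : nat := ((i + n).-1 %% 7).+1.

(* e_i e_j = e_k is one of e_2 e_6 = e_3 e_4 = e_5 e_7 = e_1 up to a cyclic
   permutation of the indices. *)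
Definition oct_rel (i j k : nat) : bool :=
  has (fun n => (i, j, k) \in
    [:: (cyc7 n 2, cyc7 n 6, cyc7 n 1);
        (cyc7 n 3, cyc7 n 4, cyc7 n 1);
        (cyc7 n 5, cyc7 n 7, cyc7 n 1)]) (iota 0 7).

(* The relations determine each product of two distinct imaginary units, in
   exactly one of the two orders. *)
Lemma oct_rel_unique :
  all (fun i => all (fun j => (i == j) ||
    (count (oct_rel i j) (iota 1 7) + count (oct_rel j i) (iota 1 7) == 1)%N)
    (iota 1 7)) (iota 1 7).
Proof. by []. Qed.

(* Coefficient of e_k in e_i e_j. *)
Definition oct_coef (R : realType) (i j k : nat) : R :=
  if i == 0%N then (j == k)%:R
  else if j == 0%N then (i == k)%:R
  else if i == j then - (k == 0%N)%:R
  else (oct_rel i j k)%:R - (oct_rel j i k)%:R.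

Definition oct_mul (R : realType) (x y : octonion R) : octonion R :=
  \row_(k < 8) \sum_(i < 8) \sum_(j < 8) oct_coef R i j k * x 0 i * y 0 j.

Notation "x *o y" := (oct_mul x y) (at level 40, left associativity).

Definition oct_real (R : realType) (a : R) : octonion R := a *: delta_mx 0 0.

Definition oct_conj (R : realType) (x : octonion R) : octonion R :=
  \row_i (if i == 0 then x 0 i else - x 0 i).

Definition oct_norm (R : realType) (x : octonion R) : R :=
  \sum_i x 0 i ^+ 2.

Definition oct_abs (R : realType) (x : octonion R) : R :=
  Num.sqrt (oct_norm x).

(* Junk value: the inverse of 0 is 0. *)
Definition oct_inv (R : realType) (x : octonion R) : octonion R :=
  (oct_norm x)^-1 *: oct_conj x.

Inductive cay_point (R : realType) : Type :=
| Affine of octonion R & octonion R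
| Slope of octonion R
| Vertical.
Arguments Vertical {R}.

Definition line_slope (R : realType) (u v : octonion R) : set (cay_point R) :=
  [set Affine x (u *o x + v) | x in setT] `|` [set Slope u].

Definition line_vertical (R : realType) (u : octonion R) : set (cay_point R) :=
  [set Affine u y | y in setT] `|` [set Vertical].

Definition line_infinity (R : realType) : set (cay_point R) :=
  [set Slope u | u in setT] `|` [set Vertical].
Arguments line_infinity R : clear implicits.

Definition cay_lines (R : realType) : set (set (cay_point R)) :=
  [set L | [\/ exists u v, L = line_slope u v,
               exists u, L = line_vertical u |
               L = line_infinity R]].
Arguments cay_lines R : clear implicits.

Definition collineation (R : realType) (g : cay_point R -> cay_point R) : Prop :=
  bijective g /\ [set g @` L | L in cay_lines R] = cay_lines R.

Definition polarity (R : realType) (p : cay_point R) : set (cay_point R) :=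
  match p with
  | Affine x y =>
      if y != 0 then
        line_slope (- oct_conj (x *o oct_inv y)) (oct_conj (oct_inv y))
      else if x != 0 then line_vertical (oct_conj (oct_inv x))
      else line_infinity R
  | Slope u =>
      if u != 0 then line_slope (- oct_conj (oct_inv u)) 0
      else line_vertical 0
  | Vertical => line_slope 0 0
  end.

(* The action of the polarity on lines, as a relation: q is a common point of
   the lines [polarity a], for a in L. *)
Definition pole (R : realType) (L : set (cay_point R)) (q : cay_point R) : Prop :=
  forall a, L a -> polarity a q.

Definition commutes_with_polarity (R : realType)
    (g : cay_point R -> cay_point R) : Prop :=
  forall p, polarity (g p) = g @` polarity p.

(* Commutation on points entails commutation on lines. *)
Lemma commutes_with_polarity_pole (R : realType)
    (g : cay_point R -> cay_point R) (L : set (cay_point R)) (q : cay_point R) :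
  commutes_with_polarity g -> pole L q -> pole (g @` L) (g q).
Proof.
by move=> cg Lq _ [a La <-]; rewrite cg; exists q => //; apply: Lq.
Qed.

Definition hyperbolic_plane (R : realType) : set (octonion R * octonion R) :=
  [set x | oct_abs x.1 ^+ 2 + oct_abs x.2 ^+ 2 < 1].
Arguments hyperbolic_plane R : clear implicits.

Definition aut_group (R : realType) : set (cay_point R -> cay_point R) :=
  [set g | @collineation R g /\ commutes_with_polarity g].
Arguments aut_group R : clear implicits.

Definition cosh (R : realType) (t : R) : R := (expR t + expR (- t)) / 2.
Definition sinh (R : realType) (t : R) : R := (expR t - expR (- t)) / 2.

(* The formula for a_t; on the hyperbolic plane the denominator is nonzero. *)
Definition a_formula (R : realType) (t : R) (x1 x2 : octonion R) : cay_point R :=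
  let d := sinh t *: x1 + oct_real (cosh t) in
  Affine ((cosh t *: x1 + oct_real (sinh t)) *o oct_inv d) (x2 *o oct_inv d).

(* g = a_t, the element of the automorphism group determined by its action on
   the hyperbolic plane. *)
Definition is_a (R : realType) (t : R) (g : cay_point R -> cay_point R) : Prop :=
  aut_group R g /\
  forall x1 x2, hyperbolic_plane R (x1, x2) -> g (Affine x1 x2) = a_formula t x1 x2.

Definition group_A (R : realType) : set (cay_point R -> cay_point R) :=
  [set g | exists t, is_a t g].
Arguments group_A R : clear implicits.

Definition stabilizer (R : realType) (H : set (cay_point R -> cay_point R))
    (p : cay_point R) : set (cay_point R -> cay_point R) :=
  [set g | H g /\ g p = p].

Definition group_K (R : realType) : set (cay_point R -> cay_point R) :=
  stabilizer (aut_group R) (Affine 0 0).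
Arguments group_K R : clear implicits.

Definition commutant (R : realType) (S H : set (cay_point R -> cay_point R)) :
    set (cay_point R -> cay_point R) :=
  [set k | H k /\ forall a, S a -> k \o a = a \o k].

Definition group_M (R : realType) : set (cay_point R -> cay_point R) :=
  commutant (group_A R) (group_K R).
Arguments group_M R : clear implicits.

Lemma oct_mul_delta (R : realType) (i j : 'I_8) :
  delta_mx 0 i *o delta_mx 0 j = \row_k oct_coef R i j k.
Proof.
apply/rowP => k; rewrite !mxE (bigD1 i) //= [X in _ + X]big1 => [|i' /negPf ni].
  rewrite addr0 (bigD1 j) //= [X in _ + X]big1 => [|j' /negPf nj].
    by rewrite addr0 !mxE !eqxx !mulr1.
  by rewrite !mxE nj !andbF mulr0.
by rewrite big1 // => j' _; rewrite !mxE ni !andbF mulr0 mul0r.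
Qed.

(* Main.v *)
Require Import Defs.
From HB Require Import structures.
From mathcomp Require Import all_boot all_order all_algebra ring lra.
From mathcomp Require Import boolp classical_sets reals sequences exp.
Import Order.TTheory GRing.Theory Num.Theory.
Local Open Scope classical_set_scope.
Local Open Scope ring_scope.

Set Implicit Arguments.
Unset Strict Implicit.
Unset Printing Implicit Defensive.

(* If [g] in [K] commutes with the [a_t], it fixes [a_t(0,0) = (tanh t, 0)];
   for [t = ln 2] this is [(3/5, 0)]. An element of [K] fixing some [(r, 0)]
   with [r <> 0] preserves the line at infinity, the axis [y = 0] and, by
   polarity, the vertical direction, hence has the form
   [(x, y) |-> (al x, be y)] with [be (u x + v) = ga u (al x) + be v]. In
   particular [al] is additive, so [al (3/5) = 3/5] gives [al 1 = 1].

   Conversely [al 1 = 1] gives [be (u x) = be u (al x)]. Commutation with the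
   polarity makes [al] commute with conjugation, so it maps reals to reals by a
   ring endomorphism of the real field, which is the identity. Therefore [al]
   and [be] are linear isometries, and [g] commutes with the formula for [a_t]
   on the hyperbolic plane; two collineations that agree there are equal. *)

(** * Octonion algebra *)

(** Finite sequences make coordinates computable, so that an octonion identity splits into eight
    polynomial ones. Missing entries read as 0. *)
Definition oct_of (R : realType) (s : seq R) : octonion R := \row_(i < 8) s`_i.

(** The multiplication table encoded by [oct_coef], expanded into polynomials. *)
Definition coord_mul (R : realType) (f g : nat -> R) : seq R :=
  [::
            f 0 * g 0 - f 1 * g 1 - f 2 * g 2 - f 3 * g 3 - f 4 * g 4 - f 5 *
        g 5 - f 6 * g 6 - f 7 * g 7;
            f 0 * g 1 + f 1 * g 0 + f 2 * g 6 + f 3 * g 4 - f 4 * g 3 + f 5 *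
        g 7 - f 6 * g 2 - f 7 * g 5;
            f 0 * g 2 - f 1 * g 6 + f 2 * g 0 + f 3 * g 7 + f 4 * g 5 - f 5 *
        g 4 + f 6 * g 1 - f 7 * g 3;
            f 0 * g 3 - f 1 * g 4 - f 2 * g 7 + f 3 * g 0 + f 4 * g 1 + f 5 *
        g 6 - f 6 * g 5 + f 7 * g 2;
            f 0 * g 4 + f 1 * g 3 - f 2 * g 5 - f 3 * g 1 + f 4 * g 0 + f 5 *
        g 2 + f 6 * g 7 - f 7 * g 6;
            f 0 * g 5 - f 1 * g 7 + f 2 * g 4 - f 3 * g 6 - f 4 * g 2 + f 5 *
        g 0 + f 6 * g 3 + f 7 * g 1;
            f 0 * g 6 + f 1 * g 2 - f 2 * g 1 + f 3 * g 5 - f 4 * g 7 - f 5 *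
        g 3 + f 6 * g 0 + f 7 * g 4;
            f 0 * g 7 + f 1 * g 5 + f 2 * g 3 - f 3 * g 2 + f 4 * g 6 - f 5 *
        g 1 - f 6 * g 4 + f 7 * g 0].

Definition coord_conj (R : realType) (f : nat -> R) : seq R :=
  [:: f 0; - f 1; - f 2; - f 3; - f 4; - f 5; - f 6; - f 7].

Lemma oct_ofP (R : realType) (x : octonion R) : exists s, x = oct_of s.
Proof.
exists (mkseq (fun i => x 0 (inord i)) 8); apply/rowP => i.
by rewrite mxE nth_mkseq // inord_val.
Qed.

Lemma oct_ofM (R : realType) (s t : seq R) :
  oct_of s *o oct_of t = oct_of (coord_mul (nth 0 s) (nth 0 t)).
Proof.
apply/rowP => k; rewrite !mxE /=.
under eq_bigr => i _ do under eq_bigr => j _ do rewrite !mxE.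
(* Sums over ['I_8] become sums over a list of numbers, which [unlock] expands into explicit
   terms. *)
under eq_bigr => i _.
  rewrite -(big_mkord xpredT (fun j => oct_coef R i j k * s`_i * t`_j)).
  over.
rewrite -(big_mkord xpredT
  (fun i => \sum_(0 <= j < 8) oct_coef R i j k * s`_i * t`_j)).
rewrite unlock.
case: k => -[|[|[|[|[|[|[|[|//]]]]]]]] ?; rewrite /oct_coef /=.
all: ring.
Qed.

Lemma oct_of_conj (R : realType) (s : seq R) :
  oct_conj (oct_of s) = oct_of (coord_conj (nth 0 s)).
Proof. by apply/rowP => -[[|[|[|[|[|[|[|[|//]]]]]]]] ?]; rewrite !mxE. Qed.

Lemma oct_of_norm (R : realType) (s : seq R) :
  oct_norm (oct_of s) = \sum_(0 <= i < 8) s`_i ^+ 2.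
Proof. by rewrite big_mkord; apply: eq_bigr => i _; rewrite mxE. Qed.

Lemma oct_conjM (R : realType) (x y : octonion R) :
  oct_conj (x *o y) = oct_conj y *o oct_conj x.
Proof.
have [[f ->] [g ->]] := (oct_ofP x, oct_ofP y).
rewrite !(oct_ofM, oct_of_conj).
by apply/rowP => -[[|[|[|[|[|[|[|[|//]]]]]]]] ?]; rewrite !mxE /=; ring.
Qed.

(** A form of the alternative law. Together with [oct_conjM] it replaces associativity in all the
    cancellation rules below. *)
Lemma oct_mulrK_conj (R : realType) (x y : octonion R) :
  (x *o y) *o oct_conj y = oct_norm y *: x.
Proof.
have [[f ->] [g ->]] := (oct_ofP x, oct_ofP y).
rewrite !(oct_ofM, oct_of_conj, oct_of_norm).
by apply/rowP => -[[|[|[|[|[|[|[|[|//]]]]]]]] ?]; rewrite !mxE unlock /=; ring.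
Qed.

Section OctonionAlgebra.
Variable R : realType.
Implicit Types (x y z w : octonion R) (a b : R).

Lemma oct_mulDl x y z : (x + y) *o z = x *o z + y *o z.
Proof.
apply/rowP => k; rewrite !mxE -big_split; apply: eq_bigr => i _.
by rewrite -big_split; apply: eq_bigr => j _; rewrite mxE /=; ring.
Qed.

Lemma oct_mulDr x y z : x *o (y + z) = x *o y + x *o z.
Proof.
apply/rowP => k; rewrite !mxE -big_split; apply: eq_bigr => i _.
by rewrite -big_split; apply: eq_bigr => j _; rewrite mxE /=; ring.
Qed.

Lemma oct_mulZl a x y : (a *: x) *o y = a *: (x *o y).
Proof.
apply/rowP => k; rewrite !mxE big_distrr; apply: eq_bigr => i _.
by rewrite big_distrr; apply: eq_bigr => j _; rewrite mxE /=; ring.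
Qed.

Lemma oct_mulZr a x y : x *o (a *: y) = a *: (x *o y).
Proof.
apply/rowP => k; rewrite !mxE big_distrr; apply: eq_bigr => i _.
by rewrite big_distrr; apply: eq_bigr => j _; rewrite mxE /=; ring.
Qed.

Lemma oct_mul0l x : 0 *o x = 0.
Proof. by rewrite -(scale0r x) oct_mulZl !scale0r. Qed.

Lemma oct_mul0r x : x *o 0 = 0.
Proof. by rewrite -(scale0r x) oct_mulZr !scale0r. Qed.

Lemma oct_mulNl x y : (- x) *o y = - (x *o y).
Proof. by rewrite -scaleN1r oct_mulZl scaleN1r. Qed.

Lemma oct_mulNr x y : x *o (- y) = - (x *o y).
Proof. by rewrite -scaleN1r oct_mulZr scaleN1r. Qed.

Lemma oct_real_of a : oct_real a = oct_of [:: a].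
Proof.
by apply/rowP => -[[|i] ?]; rewrite !mxE ?mulr1 //= mulr0 nth_nil.
Qed.

Lemma oct_mul_reall a x : oct_real a *o x = a *: x.
Proof.
have [s ->] := oct_ofP x; rewrite oct_real_of oct_ofM.
by apply/rowP => -[[|[|[|[|[|[|[|[|//]]]]]]]] ?]; rewrite !mxE /=; ring.
Qed.

Lemma oct_mul_realr a x : x *o oct_real a = a *: x.
Proof.
have [s ->] := oct_ofP x; rewrite oct_real_of oct_ofM.
by apply/rowP => -[[|[|[|[|[|[|[|[|//]]]]]]]] ?]; rewrite !mxE /=; ring.
Qed.

Lemma oct_mul1l x : oct_real 1 *o x = x.
Proof. by rewrite oct_mul_reall scale1r. Qed.

Lemma oct_mul1r x : x *o oct_real 1 = x.
Proof. by rewrite oct_mul_realr scale1r. Qed.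

Lemma oct_realD a b : oct_real (a + b) = oct_real a + oct_real b.
Proof. exact: scalerDl. Qed.

Lemma oct_realM a b : oct_real (a * b) = a *: oct_real b.
Proof. by rewrite /oct_real scalerA. Qed.

Lemma oct_realE a : oct_real a 0 0 = a.
Proof. by rewrite !mxE /= mulr1. Qed.

Lemma oct_real_eq0 a : (oct_real a == 0) = (a == 0).
Proof.
apply/eqP/eqP => [/rowP/(_ 0)|->]; last exact: scale0r.
by rewrite oct_realE mxE.
Qed.

Lemma oct_conjD x y : oct_conj (x + y) = oct_conj x + oct_conj y.
Proof. by apply/rowP => i; rewrite !mxE; case: ifP => // _; rewrite opprD. Qed.

Lemma oct_conjZ a x : oct_conj (a *: x) = a *: oct_conj x.
Proof. by apply/rowP => i; rewrite !mxE; case: ifP => // _; rewrite mulrN. Qed.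

Lemma oct_conjN x : oct_conj (- x) = - oct_conj x.
Proof. by rewrite -!scaleN1r oct_conjZ. Qed.

Lemma oct_conj0 : oct_conj (0 : octonion R) = 0.
Proof. by rewrite -(scale0r 0) oct_conjZ !scale0r. Qed.

Lemma oct_conjK x : oct_conj (oct_conj x) = x.
Proof. by apply/rowP => i; rewrite !mxE; case: (i == 0); rewrite ?opprK. Qed.

Lemma oct_conj_real a : oct_conj (oct_real a) = oct_real a.
Proof.
by apply/rowP => i; rewrite !mxE; case: (i == 0); rewrite ?mulr0 ?oppr0.
Qed.

Lemma oct_conj_fixed x : oct_conj x = x -> x = oct_real (x 0 0).
Proof.
move=> /rowP fx; apply/rowP => i; have := fx i; rewrite !mxE /=.
by case: eqP => [-> _|_ /= h]; [rewrite mulr1|rewrite mulr0; lra].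
Qed.

Lemma oct_norm_ge0 x : 0 <= oct_norm x.
Proof. by apply: sumr_ge0 => i _; apply: sqr_ge0. Qed.

Lemma oct_norm_eq0 x : (oct_norm x == 0) = (x == 0).
Proof.
apply/eqP/eqP => [/eqP|->]; last first.
  by apply: big1 => i _; rewrite mxE expr0n.
rewrite psumr_eq0 => [/allP nx|i _]; last exact: sqr_ge0.
apply/rowP => i; rewrite mxE; apply/eqP.
by rewrite -sqrf_eq0; apply: nx; rewrite mem_index_enum.
Qed.

Lemma oct_normZ a x : oct_norm (a *: x) = a ^+ 2 * oct_norm x.
Proof.
by rewrite /oct_norm big_distrr; apply: eq_bigr => i _; rewrite mxE exprMn.
Qed.

Lemma oct_norm_real a : oct_norm (oct_real a) = a ^+ 2.
Proof.
rewrite oct_real_of oct_of_norm unlock /=; ring.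
Qed.

Lemma oct_norm_conj x : oct_norm (oct_conj x) = oct_norm x.
Proof. by apply: eq_bigr => i _; rewrite mxE; case: ifP; rewrite ?sqrrN. Qed.

Lemma oct_norm0 : oct_norm (0 : octonion R) = 0.
Proof. by apply/eqP; rewrite oct_norm_eq0. Qed.

Lemma oct_conj_eq0 x : (oct_conj x == 0) = (x == 0).
Proof. by rewrite -!oct_norm_eq0 oct_norm_conj. Qed.

(** The mirror image of [oct_mulrK_conj] under conjugation. *)
Lemma oct_mulKr_conj x y : oct_conj x *o (x *o y) = oct_norm x *: y.
Proof.
have := congr1 (@oct_conj R) (oct_mulrK_conj (oct_conj y) (oct_conj x)).
by rewrite !(oct_conjM, oct_conjK, oct_conjZ) oct_norm_conj.
Qed.

Lemma oct_mul_eq0 x y : (x *o y == 0) = (x == 0) || (y == 0).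
Proof.
apply/eqP/orP => [xy0|[/eqP->|/eqP->]]; rewrite ?oct_mul0l ?oct_mul0r //.
have := oct_mulrK_conj x y; rewrite xy0 oct_mul0l => /esym/eqP.
by rewrite scaler_eq0 oct_norm_eq0 orbC => /orP.
Qed.

(* [conj (xy) ((xy) conj y)] can be computed by cancelling [xy], or by
   cancelling [y] and then [x]. *)
Lemma oct_normM x y : oct_norm (x *o y) = oct_norm x * oct_norm y.
Proof.
have [->|y0] := eqVneq y 0; first by rewrite oct_mul0r oct_norm0 mulr0.
have := oct_mulKr_conj (x *o y) (oct_conj y).
rewrite oct_mulrK_conj oct_mulZr oct_conjM.
rewrite -{2}(oct_conjK x) oct_mulrK_conj oct_norm_conj scalerA => /eqP.
rewrite -subr_eq0 -scalerBl scaler_eq0 oct_conj_eq0 (negPf y0) orbF subr_eq0.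
by rewrite mulrC => /eqP.
Qed.

Lemma oct_inv0 : oct_inv (0 : octonion R) = 0.
Proof. by rewrite /oct_inv oct_conj0 scaler0. Qed.

Lemma oct_inv_eq0 x : (oct_inv x == 0) = (x == 0).
Proof.
by rewrite scaler_eq0 invr_eq0 oct_norm_eq0 oct_conj_eq0 orbb.
Qed.

Lemma oct_invZ a x : oct_inv (a *: x) = a^-1 *: oct_inv x.
Proof.
rewrite /oct_inv oct_normZ oct_conjZ !scalerA; congr (_ *: _).
have [->|a0] := eqVneq a 0; first by rewrite invr0 mulr0 mul0r.
by rewrite invfM mulrAC; congr (_ * _); field.
Qed.

Lemma oct_inv_real a : oct_inv (oct_real a) = oct_real a^-1.
Proof.
rewrite /oct_inv oct_norm_real oct_conj_real -oct_realM; congr oct_real.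
by have [->|a0] := eqVneq a 0; [rewrite mulr0 invr0|field].
Qed.

Lemma oct_inv_conj x : oct_inv (oct_conj x) = oct_conj (oct_inv x).
Proof. by rewrite /oct_inv oct_norm_conj oct_conjZ. Qed.

Lemma oct_conj_inv x : oct_conj (oct_inv x) = (oct_norm x)^-1 *: x.
Proof. by rewrite oct_conjZ oct_conjK. Qed.

Lemma oct_invM x y : oct_inv (x *o y) = oct_inv y *o oct_inv x.
Proof.
by rewrite /oct_inv oct_normM oct_conjM oct_mulZl oct_mulZr scalerA invfM mulrC.
Qed.

Lemma oct_mulrK x y : y != 0 -> (x *o y) *o oct_inv y = x.
Proof.
by move=> y0; rewrite oct_mulZr oct_mulrK_conj scalerK // oct_norm_eq0.
Qed.

Lemma oct_mulKr x y : x != 0 -> oct_inv x *o (x *o y) = y.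
Proof.
by move=> x0; rewrite oct_mulZl oct_mulKr_conj scalerK // oct_norm_eq0.
Qed.

Lemma oct_invK x : oct_inv (oct_inv x) = x.
Proof.
have [->|x0] := eqVneq x 0; first by rewrite !oct_inv0.
rewrite oct_invZ invrK oct_inv_conj oct_conj_inv scalerA mulfV ?scale1r //.
by rewrite oct_norm_eq0.
Qed.

Lemma oct_mulrVK x y : y != 0 -> (x *o oct_inv y) *o y = x.
Proof. by move=> y0; rewrite -{2}(oct_invK y) oct_mulrK ?oct_inv_eq0. Qed.

Lemma oct_mulrV x : x != 0 -> x *o oct_inv x = oct_real 1.
Proof. by move=> x0; rewrite -{1}(oct_mul1l x) oct_mulrK. Qed.

Lemma oct_mulVr x : x != 0 -> oct_inv x *o x = oct_real 1.
Proof. by move=> x0; rewrite -{2}(oct_mul1r x) oct_mulKr. Qed.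

Lemma oct_mulrI x y z : x != 0 -> x *o y = x *o z -> y = z.
Proof. by move=> x0 e; rewrite -(oct_mulKr y x0) e oct_mulKr. Qed.

Lemma oct_mulIr x y z : x != 0 -> y *o x = z *o x -> y = z.
Proof. by move=> x0 e; rewrite -(oct_mulrK y x0) e oct_mulrK. Qed.

End OctonionAlgebra.

(** * Lines and collineations of the projective plane *)

Section Plane.
Variable R : realType.
Implicit Types (x y u v : octonion R) (p q l m : cay_point R).
Implicit Types (f g : cay_point R -> cay_point R).

(* Lines are given coordinates of the same shape as points, so that the
   polarity becomes the self-map [polar] of [cay_point R]. *)
Definition incident l p : Prop :=
  match l, p with
  | Affine u v, Affine x y => y = u *o x + v
  | Affine u _, Slope w => w = u
  | Slope u, Affine x _ => x = u
  | Slope _, Vertical => True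
  | Vertical, Slope _ => True
  | Vertical, Vertical => True
  | _, _ => False
  end.

Definition line_of l : set (cay_point R) := [set p | incident l p].

Lemma line_slopeE u v : line_slope u v = line_of (Affine u v).
Proof.
apply/seteqP; split=> [p [[x _ <-]|->] //|[x y|w|] //= h].
  by left; exists x; rewrite ?h.
by right; rewrite /= h.
Qed.

Lemma line_verticalE u : line_vertical u = line_of (Slope u).
Proof.
apply/seteqP; split=> [p [[x _ <-]|->] //|[x y|w|] //= h].
  by left; exists y; rewrite ?h.
by right.
Qed.

Lemma line_infinityE : line_infinity R = line_of Vertical.
Proof.
apply/seteqP; split=> [p [[x _ <-]|->] //|[x y|w|] //= h].
  by left; exists w.
by right.
Qed.

Lemma cay_linesE : cay_lines R = range line_of.
Proof.
apply/seteqP; split=> [L [[u [v ->]]|[u ->]|->]|L [[u v|u|] _ <-]].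
- by exists (Affine u v); rewrite ?line_slopeE.
- by exists (Slope u); rewrite ?line_verticalE.
- by exists Vertical; rewrite ?line_infinityE.
- by apply: Or31; exists u, v; rewrite line_slopeE.
- by apply: Or32; exists u; rewrite line_verticalE.
- by apply: Or33; rewrite line_infinityE.
Qed.

Definition polar p : cay_point R :=
  match p with
  | Affine x y =>
      if y != 0 then Affine (- oct_conj (x *o oct_inv y)) (oct_conj (oct_inv y))
      else if x != 0 then Slope (oct_conj (oct_inv x)) else Vertical
  | Slope u =>
      if u != 0 then Affine (- oct_conj (oct_inv u)) 0 else Slope 0
  | Vertical => Affine 0 0
  end.

Lemma polarityE p : polarity p = line_of (polar p).
Proof.
case: p => [x y|u|] /=; last exact: line_slopeE.
  case: ifP => _; first exact: line_slopeE.
  by case: ifP => _; [apply: line_verticalE|apply: line_infinityE].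
by case: ifP => _; [apply: line_slopeE|apply: line_verticalE].
Qed.

(** For two sloped lines sharing two affine points, subtracting the equations gives
    [(u - u') *o (x - x') = 0], and there are no zero divisors. *)
Lemma incident_unique l m p q :
  incident l p -> incident l q -> incident m p -> incident m q ->
  p = q \/ l = m.
Proof.
have key u v u' v' x x' : u *o x + v = u' *o x + v' ->
    u *o x' + v = u' *o x' + v' -> x <> x' -> u = u' /\ v = v'.
  move=> e1 e2 nx; have : (u - u') *o (x - x') = 0.
    rewrite !(oct_mulDl, oct_mulDr, oct_mulNl, oct_mulNr).
    have -> : u *o x = u' *o x + v' - v by rewrite -e1 addrK.
    have -> : u *o x' = u' *o x' + v' - v by rewrite -e2 addrK.
    by apply/rowP => i; rewrite !mxE; ring.
  move/eqP; rewrite oct_mul_eq0 !subr_eq0 => /orP[/eqP uu|/eqP //].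
  by split=> //; move: e1; rewrite uu => /addrI.
case: l m p q => [u v|u|] [u' v'|u'|] [x y|w|] [x' y'|w'|] //=;
  try by [left|right].
all: try by move=> *; subst; left.
all: try by move=> *; subst; right.
- move=> -> -> e1 e2; have [->|/eqP nx] := eqVneq x x'; first by left.
  by right; have [-> ->] := key _ _ _ _ _ _ e1 e2 nx.
- by move=> -> -> + e; rewrite -e => /addrI ->; right.
- by move=> -> -> <- /addrI ->; right.
Qed.

Lemma hyperbolic_planeE x y :
  hyperbolic_plane R (x, y) <-> oct_norm x + oct_norm y < 1.
Proof. by rewrite /hyperbolic_plane /= /oct_abs !sqr_sqrtr ?oct_norm_ge0. Qed.

(** * Collineations are determined by their values on the hyperbolic plane *)

Lemma collineation_image g l :
  collineation g -> exists m, g @` line_of l = line_of m.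
Proof.
move=> [_]; rewrite cay_linesE => E.
have : range line_of (g @` line_of l).
  by rewrite -E; exists (line_of l) => //; exists l.
by case=> m _ <-; exists m.
Qed.

Lemma collineation_comp f g :
  collineation f -> collineation g -> collineation (f \o g).
Proof.
move=> [bf Ef] [bg Eg]; split; first exact: bij_comp.
rewrite -[RHS]Ef -[X in _ = _ @` X]Eg [RHS]image_comp; congr (_ @` _).
by apply/funext => L; rewrite /= image_comp.
Qed.

Definition agree_twice f g l : Prop :=
  exists p q, [/\ p <> q, incident l p, incident l q, f p = g p & f q = g q].

(** By [incident_unique], the image of a line is determined by the images of two of its points. *)
Lemma agree_image f g l : collineation f -> collineation g ->
  agree_twice f g l -> f @` line_of l = g @` line_of l.
Proof.
move=> cf cg [p [q [npq lp lq fp fq]]].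
have [[m Em] [m' Em']] := (collineation_image l cf, collineation_image l cg).
rewrite Em Em'; congr line_of.
have mp : line_of m (f p) by rewrite -Em; exists p.
have mq : line_of m (f q) by rewrite -Em; exists q.
have mp' : line_of m' (f p) by rewrite -Em' fp; exists p.
have mq' : line_of m' (f q) by rewrite -Em' fq; exists q.
by have [/(bij_inj cf.1)|] := incident_unique mp mq mp' mq'.
Qed.

(** The images of [l] and [m] under [g] meet only in [g p], because [g] is injective and [l], [m]
    meet only in [p]. *)
Lemma agree_meet f g l m p : collineation f -> collineation g -> l <> m ->
  agree_twice f g l -> agree_twice f g m -> incident l p -> incident m p ->
  f p = g p.
Proof.
move=> cf cg nlm /(agree_image cf cg) El /(agree_image cf cg) Em lp mp.
have : (g @` line_of l) (f p) by rewrite -El; exists p.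
case=> q lq gq; have : (g @` line_of m) (f p) by rewrite -Em; exists p.
case=> q' mq' gq'.
have qq' : q' = q by apply: (bij_inj cg.1); rewrite gq gq'.
move: mq'; rewrite qq' => mq; have [e|/nlm //] := incident_unique lp lq mp mq.
by rewrite -gq e.
Qed.

(** Agreement spreads from a square in the ball to two points at infinity, then to all slopes, and
    finally to every affine point as the meet of two lines already carrying two points of
    agreement. *)
Lemma agree_on_hyperbolic_plane f g : collineation f -> collineation g ->
  (forall x y, hyperbolic_plane R (x, y) -> f (Affine x y) = g (Affine x y)) ->
  f = g.
Proof.
move=> cf cg fg.
(* With [h = 1/2] the square with corners (0, 0), (0, h), (h, 0), (h, h) lies in the ball; its
   opposite sides meet at [Vertical] and at [Slope 0]. *)
pose h : octonion R := oct_real 2^-1.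
have h0 : h != 0 by rewrite oct_real_eq0 invr_eq0 pnatr_eq0.
have nh : oct_norm h = 4^-1 by rewrite oct_norm_real; field.
have fg2 x y : oct_norm x + oct_norm y < 1 -> f (Affine x y) = g (Affine x y).
  by move=> xy; apply/fg/hyperbolic_planeE.
have E00 : f (Affine 0 0) = g (Affine 0 0).
  by apply: fg2; rewrite oct_norm0; lra.
have E0h : f (Affine 0 h) = g (Affine 0 h).
  by apply: fg2; rewrite oct_norm0 nh; lra.
have Eh0 : f (Affine h 0) = g (Affine h 0).
  by apply: fg2; rewrite oct_norm0 nh; lra.
have Ehh : f (Affine h h) = g (Affine h h).
  by apply: fg2; rewrite nh; lra.
have h0' : 0 <> h by apply/eqP; rewrite eq_sym.
have EV : f Vertical = g Vertical.
  apply: (@agree_meet f g (Slope 0) (Slope h)) => //; first by case.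
    by exists (Affine 0 0), (Affine 0 h); split=> //; case.
  by exists (Affine h 0), (Affine h h); split=> //; case.
have ES0 : f (Slope 0) = g (Slope 0).
  apply: (@agree_meet f g (Affine 0 0) (Affine 0 h)) => //; first by case.
    by exists (Affine 0 0), (Affine h 0); split=> //=;
      rewrite ?oct_mul0l ?addr0 //; case.
  by exists (Affine 0 h), (Affine h h); split=> //=;
    rewrite ?oct_mul0l ?add0r //; case.
have ES u : f (Slope u) = g (Slope u).
  apply: (@agree_meet f g Vertical (Affine u 0)) => //.
    by exists Vertical, (Slope 0).
  (* The factor [d] brings a point of the line [y = u x] into the ball: [d^2 (1 + N(u)) < 1]. *)
  have nu := oct_norm_ge0 u; pose d := (2 + oct_norm u)^-1.
  have d0 : d != 0 by rewrite invr_eq0; lra.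
  exists (Affine 0 0), (Affine (oct_real d) (d *: u)); split=> //=.
  - by case=> /esym/eqP; rewrite oct_real_eq0 (negPf d0).
  - by rewrite oct_mul0r addr0.
  - by rewrite oct_mul_realr addr0.
  apply: fg2; rewrite oct_norm_real oct_normZ -[X in X + _]mulr1 -mulrDr.
  rewrite /d exprVn mulrC ltr_pdivrMr ?mul1r; nra.
apply/funext => -[x y|u|] //.
have [->|x0] := eqVneq x 0; last first.
  (* The lines joining (x, y) to (0, 0) and to (0, h). *)
  apply: (@agree_meet f g (Affine (y *o oct_inv x) 0)
                          (Affine ((y - h) *o oct_inv x) h)) => //.
  - by case=> _.
  - exists (Affine 0 0), (Slope (y *o oct_inv x)); split=> //=.
    by rewrite oct_mul0r addr0.
  - exists (Affine 0 h), (Slope ((y - h) *o oct_inv x)); split=> //=.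
    by rewrite oct_mul0r add0r.
  - by rewrite /= oct_mulrVK // addr0.
  - by rewrite /= oct_mulrVK // subrK.
(* The second line joins (0, y) to (h, 0); its slope is [- 2 y] since [h = 1/2]. *)
apply: (@agree_meet f g (Slope 0) (Affine (- 2 *: y) y)) => //.
- by exists (Affine 0 0), Vertical.
- exists (Affine h 0), (Slope (- 2 *: y)); split=> //=.
  rewrite oct_mul_realr scalerA.
  by apply/rowP => i; rewrite !mxE; field.
- by rewrite /= oct_mul0r add0r.
Qed.

End Plane.

(** * The projective extension of the formula for a_t *)

Section Boost.
Variable R : realType.
Implicit Types (c s : R) (x y u v z : octonion R) (p l : cay_point R).

Definition boost_num c s x : octonion R := c *: x + oct_real s.
Definition boost_den c s x : octonion R := s *: x + oct_real c.
Definition mobius c s x : octonion R :=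
  boost_num c s x *o oct_inv (boost_den c s x).

(* The values outside the domain of [a_formula] are forced by following the
   images of the lines [y = u x + v]. Without this extension [group_A] could be
   empty. *)
Definition boost c s p : cay_point R :=
  match p with
  | Affine x y =>
      if boost_den c s x != 0
      then Affine (mobius c s x) (y *o oct_inv (boost_den c s x))
      else Slope (- s *: y)
  | Slope u => Affine (oct_real (c / s)) (s^-1 *: u)
  | Vertical => Vertical
  end.

(** The induced action on line coordinates. Clearing the denominator in the equation of the image
    line [y = u' x + v'] suggests [c u' + s v' = u] and [s u' + c v' = v], which is solved using
    [c^2 - s^2 = 1]. *)
Definition boost_line c s l : cay_point R :=
  match l with
  | Affine u v => Affine (c *: u - s *: v) (c *: v - s *: u)
  | Slope u => if boost_den c s u != 0 then Slope (mobius c s u) else Vertical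
  | Vertical => Slope (oct_real (c / s))
  end.

Section HyperbolicAngle.
Variables c s : R.
Hypotheses (cs : c ^+ 2 - s ^+ 2 = 1) (s0 : s != 0).

Lemma boost_c_neq0 : c != 0.
Proof. by apply/eqP => c0; move: cs; rewrite c0; nra. Qed.

(** Partial fractions: the numerator is [c/s] times the denominator minus [1/s]. Only one inverse
    with real coefficients remains, which avoids most associativity problems. *)
Lemma mobiusE x : boost_den c s x != 0 ->
  mobius c s x = oct_real (c / s) - s^-1 *: oct_inv (boost_den c s x).
Proof.
move=> d0; rewrite /mobius.
have -> : boost_num c s x = (c / s) *: boost_den c s x - oct_real s^-1.
  apply/rowP => i; rewrite !mxE; set e := (_ && _)%:R.
  have {1}-> : s = (c ^+ 2 - 1) / s by rewrite -cs; field.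
  by field.
by rewrite oct_mulDl oct_mulZl oct_mulrV // oct_mulNl oct_mul_reall -oct_realM
  mulr1.
Qed.

Lemma boost_den_mobius x : boost_den c s x != 0 ->
  boost_den c (- s) (mobius c s x) = oct_inv (boost_den c s x).
Proof.
move=> d0; rewrite mobiusE // /boost_den; move: (oct_inv _) => d.
by apply/rowP => i; rewrite !mxE; field.
Qed.

Lemma mobiusK x : boost_den c s x != 0 -> mobius c (- s) (mobius c s x) = x.
Proof.
move=> d0; rewrite {1}/mobius boost_den_mobius // oct_invK /boost_num.
rewrite mobiusE //.
rewrite scalerBr !oct_mulDl oct_mulNl !(oct_mulZl c).
rewrite (oct_mulZl s^-1) oct_mulVr //.
rewrite !oct_mul_reall /boost_den.
apply/rowP => i; rewrite !mxE; set e := (_ && _)%:R.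
by rewrite -[RHS]mul1r -cs; field.
Qed.

Lemma boost_den_eq0 x : boost_den c s x = 0 -> x = oct_real (- (c / s)).
Proof.
move=> d0; rewrite -[x](scalerK s0).
have -> : s *: x = - oct_real c by apply/eqP; rewrite -addr_eq0; apply/eqP.
by apply/rowP => i; rewrite !mxE; field.
Qed.

(** The value of the Moebius map at infinity is the pole of its inverse; this is where [boost] sends
    the slopes. *)
Lemma boost_den_pole : boost_den c (- s) (oct_real (c / s)) = 0.
Proof. by rewrite /boost_den; apply/rowP => i; rewrite !mxE; field. Qed.

(** Changing the sign of [s] inverts the hyperbolic rotation; the fibre over the pole is exchanged
    with points at infinity. *)
Lemma boostK : cancel (boost c s) (boost c (- s)).
Proof.
case=> [x y|u|] //=; last first.
  rewrite boost_den_pole eqxx opprK scalerA mulfV // scale1r //.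
case: eqP => /= [/boost_den_eq0 ->|/eqP d0].
  by rewrite invrN mulrN scalerA mulrNN mulVf // scale1r.
by rewrite boost_den_mobius // oct_inv_eq0 d0 mobiusK // oct_invK oct_mulrVK.
Qed.

Lemma boost_lineK : cancel (boost_line c s) (boost_line c (- s)).
Proof.
case=> [u v|u|] /=; last by rewrite boost_den_pole eqxx.
  congr Affine; apply/rowP => i; rewrite !mxE.
    by rewrite -[RHS]mul1r -cs; ring.
  by rewrite -[RHS]mul1r -cs; ring.
case: eqP => /= [/boost_den_eq0 ->|/eqP d0]; first by rewrite invrN mulrN.
by rewrite boost_den_mobius // oct_inv_eq0 d0 mobiusK.
Qed.

Lemma boost_incident l p :
  incident l p -> incident (boost_line c s l) (boost c s p).
Proof.
case: l p => [u v|u|] [x y|w|] //=; last 2 first.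
- by move=> ->; case: ifP.
- by case: ifP.
- move=> ->; case: eqP => /= [/boost_den_eq0 ->|/eqP d0].
    rewrite oct_mul_realr.
    by apply/rowP => i; rewrite !mxE; field.
  rewrite mobiusE // oct_mulDr oct_mul_realr oct_mulNr (oct_mulZr s^-1).
  rewrite !oct_mulDl oct_mulNl (oct_mulZl c) (oct_mulZl s).
  (* Expressing [u x] through [u d], with [d] the denominator, allows the cancellation of [d]
     against its inverse without reassociating. *)
  have -> : u *o x = s^-1 *: (u *o boost_den c s x - c *: u).
    by rewrite /boost_den oct_mulDr oct_mul_realr addrK oct_mulZr scalerK.
  rewrite (oct_mulZl s^-1) oct_mulDl oct_mulNl (oct_mulZl c) oct_mulrK //.
  move: (u *o _) (v *o _) => a b.
  apply/rowP => i; rewrite !mxE.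
  rewrite -[X in X - _]mul1r -cs; by field.
- move=> ->; rewrite oct_mul_realr; apply/rowP => i; rewrite !mxE.
  by rewrite -[LHS]mul1r -cs; field.
Qed.

(** By [mobiusE] this apparent reassociation reduces to cancelling the denominator against its
    inverse on the left of [z]. *)
Lemma mobius_mul x z : boost_den c s x != 0 ->
  mobius c s x *o (boost_den c s x *o z) = boost_num c s x *o z.
Proof.
move=> d0; rewrite mobiusE // oct_mulDl oct_mulNl oct_mul_reall (oct_mulZl s^-1).
rewrite oct_mulKr // /boost_den /boost_num !oct_mulDl !oct_mul_reall.
rewrite (oct_mulZl s) (oct_mulZl c).
move: (x *o z) => w; apply/rowP => i; rewrite !mxE.
rewrite -[s^-1 * _]mul1r -cs; by field.
Qed.

Lemma boost_den_conj x :
  boost_den c s (oct_conj x) = oct_conj (boost_den c s x).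
Proof. by rewrite /boost_den oct_conjD oct_conjZ oct_conj_real. Qed.

Lemma mobius_conj x : mobius c s (oct_conj x) = oct_conj (mobius c s x).
Proof.
have [d0|d0] := eqVneq (boost_den c s x) 0.
  (* At the pole both sides are 0, the inverse of 0 being 0. *)
  by rewrite /mobius boost_den_conj d0 oct_conj0 oct_inv0 !oct_mul0r oct_conj0.
rewrite !mobiusE ?boost_den_conj ?oct_conj_eq0 //.
by rewrite oct_conjD oct_conj_real oct_conjN oct_conjZ oct_inv_conj.
Qed.

Lemma boost_den_inv x : x != 0 ->
  boost_den c s (oct_inv x) = boost_num c s x *o oct_inv x.
Proof.
move=> x0; rewrite /boost_num oct_mulDl (oct_mulZl c) oct_mulrV // oct_mul_reall.
by rewrite -oct_realM mulr1 addrC.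
Qed.

(** Inversion exchanges numerator and denominator, by the symmetry of the matrix with rows (c, s)
    and (s, c). *)
Lemma mobius_inv x : x != 0 -> mobius c s (oct_inv x) = oct_inv (mobius c s x).
Proof.
move=> x0; rewrite {1}/mobius boost_den_inv // /mobius !oct_invM !oct_invK.
rewrite {1}/boost_num oct_mulDl oct_mul_reall (oct_mulZl c) oct_mulKr //.
by rewrite /boost_den oct_mulDl oct_mul_reall (oct_mulZl s) addrC.
Qed.

(** Commutation with the polarity in line coordinates. The cases follow the branches of [polar] and
    whether the image point is at infinity. *)
Lemma boost_polar p : polar (boost c s p) = boost_line c s (polar p).
Proof.
case: p => [x y|u|] /=; last by rewrite !scaler0 subrr.
  have [->|y0] := eqVneq y 0 => /=; last first.
    have [d0|d0] := eqVneq (boost_den c s x) 0 => /=.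
      rewrite scaler_eq0 oppr_eq0 (negPf s0) (negPf y0) /= (boost_den_eq0 d0).
      rewrite oct_mul_reall oct_invZ.
      move: (oct_inv y) => q; rewrite !oct_conjZ.
      congr Affine; apply/rowP => i; rewrite !mxE.
        by rewrite -[LHS]mul1r -cs; field.
      by field.
    rewrite oct_mul_eq0 oct_inv_eq0 (negPf y0) (negPf d0) /= oct_invM oct_invK.
    (* With [n] and [d] the numerator and denominator, the image (x', y') satisfies
       [y'^-1 = d y^-1], and [mobius_mul] gives [x' y'^-1 = n y^-1]. *)
    rewrite mobius_mul // /boost_num /boost_den !oct_mulDl !oct_mul_reall.
    rewrite (oct_mulZl c) (oct_mulZl s).
    move: (x *o _) => a; move: (oct_inv y) => b; rewrite !oct_conjD !oct_conjZ.
    by congr Affine; apply/rowP => i; rewrite !mxE; ring.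
  have [->|x0] := eqVneq x 0 => /=.
    (* The origin goes to (s/c, 0), whose polar is the vertical line at [c/s], the image of the line
       at infinity. *)
    rewrite /mobius /boost_num /boost_den !scaler0 !add0r oct_real_eq0.
    rewrite boost_c_neq0 /= oct_mul0l eqxx /= oct_inv_real oct_mul_realr -oct_realM.
    rewrite oct_real_eq0 mulf_eq0 invr_eq0 (negPf boost_c_neq0) (negPf s0) /=.
    by rewrite oct_inv_real oct_conj_real invfM invrK.
  rewrite -oct_inv_conj boost_den_inv ?oct_conj_eq0 //.
  rewrite mobius_inv ?oct_conj_eq0 // mobius_conj !oct_inv_conj.
  have -> : boost_num c s (oct_conj x) = oct_conj (boost_num c s x).
    by rewrite /boost_num oct_conjD oct_conjZ oct_conj_real.
  rewrite oct_mul_eq0 !oct_conj_eq0 oct_inv_eq0 (negPf x0) orbF.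
  have [d0|d0] := eqVneq (boost_den c s x) 0 => /=.
    (* At the pole [mobius c s x] is 0 by the convention on inverses, while the numerator there is
       [- 1/s], which is nonzero. *)
    rewrite scaler0 eqxx /= /mobius d0 oct_inv0 oct_mul0r oct_inv0 oct_conj0.
    rewrite (boost_den_eq0 d0) /boost_num -oct_realM -oct_realD oct_real_eq0.
    suff -> : c * - (c / s) + s = - s^-1 by rewrite oppr_eq0 invr_eq0 s0.
    by rewrite -[in RHS](mul1r s^-1) -cs; field.
  rewrite oct_mul0l eqxx /= oct_mul_eq0 oct_inv_eq0 (negPf d0) orbF.
  by case: ifP.
have [->|u0] := eqVneq u 0 => /=.
  rewrite scaler0 eqxx /= oct_real_eq0 mulf_eq0 invr_eq0.
  rewrite (negPf boost_c_neq0) (negPf s0) /= /mobius /boost_num /boost_den.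
  rewrite !scaler0 !add0r oct_real_eq0 boost_c_neq0 /= !oct_inv_real.
  by rewrite oct_conj_real oct_mul_realr -oct_realM invfM invrK mulrC.
rewrite scaler_eq0 invr_eq0 (negPf s0) (negPf u0) /=.
rewrite oct_mul_reall oct_invZ invrK.
move: (oct_inv u) => q; rewrite !oct_conjZ.
by congr Affine; apply/rowP => i; rewrite !mxE; field.
Qed.

End HyperbolicAngle.

Lemma boost_image_line c s l : c ^+ 2 - s ^+ 2 = 1 -> s != 0 ->
  boost c s @` line_of l = line_of (boost_line c s l).
Proof.
move=> cs s0; have cs' : c ^+ 2 - (- s) ^+ 2 = 1 by rewrite sqrrN.
have s0' : - s != 0 by rewrite oppr_eq0.
apply/seteqP; split=> [_ [p lp <-]|p lp]; first exact: boost_incident.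
exists (boost c (- s) p); last by move: (boostK cs' s0' p); rewrite opprK.
by rewrite -(boost_lineK cs s0 l); apply: boost_incident.
Qed.

Lemma boost_aut c s : c ^+ 2 - s ^+ 2 = 1 -> s != 0 ->
  aut_group R (boost c s).
Proof.
move=> cs s0; have cs' : c ^+ 2 - (- s) ^+ 2 = 1 by rewrite sqrrN.
have s0' : - s != 0 by rewrite oppr_eq0.
split; last by move=> p; rewrite !polarityE boost_polar // boost_image_line.
split.
  exists (boost c (- s)); first exact: boostK.
  by move: (boostK cs' s0'); rewrite opprK.
rewrite cay_linesE; apply/seteqP; split=> [_ [_ [l _ <-] <-]|_ [l _ <-]].
  by exists (boost_line c s l); rewrite ?boost_image_line.
exists (line_of (boost_line c (- s) l)); first by exists (boost_line c (- s) l).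
by move: (boost_lineK cs' s0' l); rewrite boost_image_line // opprK => ->.
Qed.

Lemma cosh2_sinh2 (t : R) : cosh t ^+ 2 - sinh t ^+ 2 = 1.
Proof.
have e : expR t * expR (- t) = 1 by rewrite -expRD subrr expR0.
by rewrite /cosh /sinh -[RHS]e; field.
Qed.

Lemma boost_is_a (t : R) : sinh t != 0 -> is_a t (boost (cosh t) (sinh t)).
Proof.
move=> s0; split=> [|x y]; first exact: boost_aut (cosh2_sinh2 t) s0.
move=> /hyperbolic_planeE xy /=.
(* A zero denominator forces [x = - coth t], of norm [1 + 1/sinh^2 t > 1], outside the ball. *)
case: eqP => //= /(boost_den_eq0 s0) ex; move: xy.
have := cosh2_sinh2 t; have := oct_norm_ge0 y; rewrite ex oct_norm_real sqrrN.
move=> y0 cs; have s2 : 0 < sinh t ^+ 2 by rewrite exprn_even_gt0.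
have -> : (cosh t / sinh t) ^+ 2 = 1 + (sinh t ^+ 2)^-1.
  by rewrite expr_div_n -(subrK (sinh t ^+ 2) (cosh t ^+ 2)) cs; field.
have : 0 < (sinh t ^+ 2)^-1 by rewrite invr_gt0.
by move: (sinh t ^- 2) y0 => r y0 r0 xy; exfalso; clear ex; lra.
Qed.

End Boost.

(** * Elements of K fixing a point of the axis y = 0 *)

(** Such a map fixes the rationals and preserves squares, hence is monotone; a rational strictly
    between [a] and [f a] would contradict this. *)
Lemma real_endo_id (R : realType) (f : R -> R) :
  (forall a b, f (a + b) = f a + f b) -> (forall a b, f (a * b) = f a * f b) ->
  f 1 = 1 -> f =1 id.
Proof.
move=> fD fM f1.
have f0 : f 0 = 0 by apply: (addrI (f 0)); rewrite -fD !addr0.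
have fN a : f (- a) = - f a by apply/eqP; rewrite -addr_eq0 -fD addNr f0.
have fB : {morph f : a b / a - b} by move=> a b; rewrite fD fN.
have fMM : monoid_morphism f by split=> [|a b]; [exact: f1|exact: fM].
pose F : {rmorphism R -> R} := HB.pack f
  (GRing.isZmodMorphism.Build R R f fB) (GRing.isMonoidMorphism.Build R R f fMM).
have fQ (q : rat) : f (ratr q) = ratr q := fmorph_rat F q.
have f_ge0 a : 0 <= a -> 0 <= f a.
  by move=> a0; rewrite -(sqr_sqrtr a0) expr2 fM -expr2 sqr_ge0.
have f_le a b : a <= b -> f a <= f b.
  by rewrite -subr_ge0 => /f_ge0; rewrite fB subr_ge0.
move=> a; apply/eqP; case: ltgtP => // lt_fa.
- have [q] := rat_in_itvoo lt_fa; rewrite in_itv /= => /andP[faq qa].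
  by have := f_le _ _ (ltW qa); rewrite fQ leNgt faq.
- have [q] := rat_in_itvoo lt_fa; rewrite in_itv /= => /andP[aq qfa].
  by have := f_le _ _ (ltW aq); rewrite fQ leNgt qfa.
Qed.

Section AxialCollineations.
Variable R : realType.
Implicit Types (x y u v r : octonion R) (p q l m : cay_point R).
Implicit Types (g : cay_point R -> cay_point R).
Implicit Types (al be ga : octonion R -> octonion R).

(** For [v = 0] the last equation is the autotopism identity of octonion multiplication. *)
Definition axial_by g al be ga : Prop :=
  [/\ forall x y, g (Affine x y) = Affine (al x) (be y),
      forall u, g (Slope u) = Slope (ga u), al 0 = 0, be 0 = 0 &
      forall u x v, be (u *o x + v) = ga u *o al x + be v].

Lemma collineation_incident g l : collineation g ->
  exists m, forall p, incident m (g p) <-> incident l p.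
Proof.
move=> cg; have [m E] := collineation_image l cg; exists m => p; split=> h.
  have : (g @` line_of l) (g p) by rewrite E.
  by case=> q lq /(bij_inj cg.1) <-.
have : line_of m (g p) by rewrite -E; exists p.
by [].
Qed.

Lemma axial_stabilizer g r : group_K R g -> r != 0 ->
  g (Affine r 0) = Affine r 0 -> exists al be ga, axial_by g al be ga.
Proof.
move=> [[cg pg] g0] r0 gr.
have gI := bij_inj cg.1.
(* The line at infinity is the polar of the fixed origin. *)
have g_inf p : incident Vertical (g p) <-> incident Vertical p.
  have := pg (Affine 0 0); rewrite g0 polarityE /= eqxx /= => E.
  split=> h; last by have : line_of Vertical (g p) by rewrite E; exists p.
  have : (g @` line_of Vertical) (g p) by rewrite -E.
  by case=> q qi /gI <-.
(* The axis joins the two fixed points (0, 0) and (r, 0). *)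
have g_axis p : incident (Affine 0 0) (g p) <-> incident (Affine 0 0) p.
  have [m mE] := collineation_incident (Affine 0 0) cg.
  have axis x : incident (Affine 0 0) (Affine x 0).
    by rewrite /= oct_mul0l addr0.
  have m0 : incident m (Affine 0 0) by rewrite -g0; apply/mE/axis.
  have mr : incident m (Affine r 0) by rewrite -gr; apply/mE/axis.
  have [[e]|e] := incident_unique (axis 0) (axis r) m0 mr.
    by move: r0; rewrite -e eqxx.
  by have := mE p; rewrite -e.
(* The polar of [Vertical] is the axis, so the polar of [g Vertical] is the image of the axis and
   contains [Slope 0]. Among points at infinity only [Vertical] has such a polar. *)
have gV : g Vertical = Vertical.
  have := pg Vertical; rewrite !polarityE => E.
  have : line_of (polar (g Vertical)) (Slope 0).
    rewrite E; have [p gp] : exists p, g p = Slope 0.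
      by case: cg.1 => g' _ gK; exists (g' (Slope 0)).
    by exists p => //; apply/g_axis; rewrite gp.
  have : incident Vertical (g Vertical) by apply/g_inf.
  case: (g Vertical) => //= u _; case: ifP => //= u0 /esym/eqP.
  by rewrite oppr_eq0 oct_conj_eq0 oct_inv_eq0 (negPf u0).
have gS0 : g (Slope 0) = Slope 0.
  have : incident Vertical (g (Slope 0)) by apply/g_inf.
  have : incident (Affine 0 0) (g (Slope 0)) by apply/g_axis.
  by case: (g _) => //= u ->.
(* Coordinate projections; [gA] and [gS] show that the default 0 is never the value read off. *)
pose cx p := if p is Affine x _ then x else 0.
pose cy p := if p is Affine _ y then y else 0.
pose cs p := if p is Slope u then u else 0.
have gA x y :
    g (Affine x y) = Affine (cx (g (Affine x y))) (cy (g (Affine x y))).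
  by have := (g_inf (Affine x y)).1; case: (g _) => //= [u|] /(_ I).
(* Fixing [Vertical] keeps vertical lines vertical; fixing [Slope 0] will likewise keep horizontal
   lines horizontal. *)
have g_vert x y : cx (g (Affine x y)) = cx (g (Affine x 0)).
  have [m mE] := collineation_incident (Slope x) cg.
  have : incident m (g (Affine x y)) by apply/mE.
  have : incident m (g (Affine x 0)) by apply/mE.
  have : incident m (g Vertical) by apply/mE.
  by rewrite gV gA (gA x y); case: m {mE} => //= u _ -> ->.
have g_horiz x y : cy (g (Affine x y)) = cy (g (Affine 0 y)).
  have [m mE] := collineation_incident (Affine 0 y) cg.
  have : incident m (g (Affine x y)) by apply/mE; rewrite /= oct_mul0l add0r.
  have : incident m (g (Affine 0 y)) by apply/mE; rewrite /= oct_mul0l add0r.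
  have : incident m (g (Slope 0)) by apply/mE.
  rewrite gS0 gA (gA x y); case: m {mE} => //= u v <-.
  by rewrite !oct_mul0l => -> ->.
have gS u : g (Slope u) = Slope (cs (g (Slope u))).
  have := (g_inf (Slope u)).2 I; have : g (Slope u) <> Vertical.
    by rewrite -gV => /gI.
  by case: (g _).
exists (fun x => cx (g (Affine x 0))), (fun y => cy (g (Affine 0 y))).
exists (fun u => cs (g (Slope u))); split=> //; rewrite ?g0 //.
  by move=> x y; rewrite [LHS]gA g_vert g_horiz.
(* The image line is identified by its point at infinity, of slope [ga u], and its point over 0, of
   height [be v]. *)
move=> u x v; have [m mE] := collineation_incident (Affine u v) cg.
have : incident m (g (Affine x (u *o x + v))) by apply/mE.
have : incident m (g (Affine 0 v)) by apply/mE; rewrite /= oct_mul0r add0r.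
have : incident m (g (Slope u)) by apply/mE.
rewrite gS (gA x) (gA 0) !g_vert g0 g_horiz; case: m {mE} => //= u' v' ->.
by rewrite oct_mul0r add0r => ->.
Qed.

(** * Linearity and isometry of the coordinate maps *)

Section AxialTheory.
Variables (g : cay_point R -> cay_point R).
Variables (al be ga : octonion R -> octonion R).
Hypotheses (gI : injective g) (gE : axial_by g al be ga).

Let gA x y : g (Affine x y) = Affine (al x) (be y). Proof. by case: gE. Qed.
Let gS u : g (Slope u) = Slope (ga u). Proof. by case: gE. Qed.
Let al0 : al 0 = 0. Proof. by case: gE. Qed.
Let be0 : be 0 = 0. Proof. by case: gE. Qed.
Let beDM u x v : be (u *o x + v) = ga u *o al x + be v. Proof. by case: gE. Qed.

Lemma axial_mul u x : be (u *o x) = ga u *o al x.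
Proof. by have := beDM u x 0; rewrite be0 !addr0. Qed.

(** The line of slope [x] and intercept [y], taken at abscissa 1; the term [ga x *o al 1] is again
    [be x]. *)
Lemma axial_beD x y : be (x + y) = be x + be y.
Proof. by have := beDM x (oct_real 1) y; rewrite -axial_mul oct_mul1r. Qed.

Lemma axial_al_inj : injective al.
Proof.
move=> x y e; have : g (Affine x 0) = g (Affine y 0) by rewrite !gA e.
by move/gI; case.
Qed.

Lemma axial_be_inj : injective be.
Proof.
move=> x y e; have : g (Affine 0 x) = g (Affine 0 y) by rewrite !gA e.
by move/gI; case.
Qed.

Lemma axial_al_eq0 x : (al x == 0) = (x == 0).
Proof. by rewrite -{1}al0 (inj_eq axial_al_inj). Qed.

Lemma axial_be_eq0 x : (be x == 0) = (x == 0).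
Proof. by rewrite -{1}be0 (inj_eq axial_be_inj). Qed.

Lemma axial_ga1 : ga (oct_real 1) != 0.
Proof.
have : be (oct_real 1) != 0 by rewrite axial_be_eq0 oct_real_eq0 oner_eq0.
by apply: contraNneq => e; rewrite -[oct_real 1]oct_mul1l axial_mul e oct_mul0l.
Qed.

(** Additivity passes from [be] to [al] since [be x = ga 1 *o al x] with [ga 1] nonzero. *)
Lemma axial_alD x y : al (x + y) = al x + al y.
Proof.
apply: (oct_mulrI axial_ga1).
by rewrite oct_mulDr -!axial_mul !oct_mul1l axial_beD.
Qed.

Lemma axial_alMn x n : al (x *+ n) = al x *+ n.
Proof. by elim: n => [|n IH]; rewrite ?mulr0n // !mulrS axial_alD IH. Qed.

Hypotheses (al1 : al (oct_real 1) = oct_real 1).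

Lemma axial_ga u : ga u = be u.
Proof. by rewrite -[in RHS](oct_mul1r u) axial_mul al1 oct_mul1r. Qed.

Lemma axial_beM u x : be (u *o x) = be u *o al x.
Proof. by rewrite axial_mul axial_ga. Qed.

Let b := be (oct_real 1).
Let b0 : b != 0. Proof. by rewrite axial_be_eq0 oct_real_eq0 oner_eq0. Qed.

Lemma axial_beE x : be x = b *o al x.
Proof. by rewrite -axial_beM oct_mul1l. Qed.

(** Multiplying on the left by [b] and then on the right by [al x], both sides become [b], because
    [be] turns [x^-1 x = 1] into such a product. *)
Lemma axial_al_inv x : al (oct_inv x) = oct_inv (al x).
Proof.
have [->|x0] := eqVneq x 0; first by rewrite oct_inv0 al0 oct_inv0.
have ax0 : al x != 0 by rewrite axial_al_eq0.
apply: (oct_mulrI b0); apply: (oct_mulIr ax0); rewrite oct_mulrVK //.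
by rewrite -axial_beE -axial_beM oct_mulVr.
Qed.

Hypothesis (pg : commutes_with_polarity g).

(** The polar of (x, 0) is a vertical line; compare the abscissas of its image and of the polar of
    the image point. *)
Lemma axial_al_conj_inv x :
  al (oct_conj (oct_inv x)) = oct_conj (oct_inv (al x)).
Proof.
have [->|x0] := eqVneq x 0.
  by rewrite oct_inv0 oct_conj0 al0 oct_inv0 oct_conj0.
have := pg (Affine x 0); rewrite gA be0 !polarityE /= eqxx /=.
rewrite axial_al_eq0 x0 => E.
have : line_of (Slope (oct_conj (oct_inv (al x))))
    (g (Affine (oct_conj (oct_inv x)) 0)).
  by rewrite E; exists (Affine (oct_conj (oct_inv x)) 0).
by rewrite gA.
Qed.

(** The same comparison for the horizontal polar of (0, y), read at abscissa 0. *)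
Lemma axial_be_conj_inv y :
  be (oct_conj (oct_inv y)) = oct_conj (oct_inv (be y)).
Proof.
have [->|y0] := eqVneq y 0.
  by rewrite oct_inv0 oct_conj0 be0 oct_inv0 oct_conj0.
have := pg (Affine 0 y); rewrite gA al0 !polarityE /= axial_be_eq0 y0 => E.
set l := Affine _ _ in E.
have : line_of l (g (Affine 0 (oct_conj (oct_inv y)))).
  rewrite E; exists (Affine 0 (oct_conj (oct_inv y))) => //=.
  by rewrite oct_mul0r add0r.
by rewrite gA /= al0 oct_mul0r add0r.
Qed.

Lemma axial_al_conj x : al (oct_conj x) = oct_conj (al x).
Proof. by rewrite -{1}(oct_invK x) axial_al_conj_inv axial_al_inv oct_invK. Qed.

Lemma axial_al_real a : al (oct_real a) = oct_real a.
Proof.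
pose f a := al (oct_real a) 0 0.
have fE c : al (oct_real c) = oct_real (f c).
  by apply: oct_conj_fixed; rewrite -axial_al_conj oct_conj_real.
rewrite fE; congr oct_real; apply: real_endo_id => [c d|c d|].
- by rewrite /f oct_realD axial_alD mxE.
(* Multiplicativity is available only in the form [axial_beM]; the product is computed through [be]
   and [b] is cancelled. *)
- have : be (oct_real c *o oct_real d) = b *o oct_real (f c * f d).
    by rewrite axial_beM axial_beE !fE !oct_mul_realr scalerA mulrC.
  rewrite oct_mul_reall -oct_realM axial_beE fE => /(oct_mulrI b0).
  by move/(congr1 (fun x => x 0 0)); rewrite !oct_realE.
by rewrite /f al1 oct_realE.
Qed.

Lemma axial_beZ a x : be (a *: x) = a *: be x.
Proof. by rewrite -oct_mul_realr axial_beM axial_al_real oct_mul_realr. Qed.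

Lemma axial_alZ a x : al (a *: x) = a *: al x.
Proof. by apply: (oct_mulrI b0); rewrite oct_mulZr -!axial_beE axial_beZ. Qed.

(** The conjugate of [x^-1] is [x] divided by its norm, so homogeneity of [al] lets the two norms be
    compared. *)
Lemma axial_al_norm x : oct_norm (al x) = oct_norm x.
Proof.
have [->|x0] := eqVneq x 0; first by rewrite al0.
have := axial_al_conj_inv x; rewrite !oct_conj_inv axial_alZ => /eqP.
rewrite -subr_eq0 -scalerBl scaler_eq0 axial_al_eq0 (negPf x0) orbF subr_eq0.
by move/eqP/invr_inj.
Qed.

Lemma axial_be_norm x : oct_norm (be x) = oct_norm x.
Proof.
have [->|x0] := eqVneq x 0; first by rewrite be0.
have := axial_be_conj_inv x; rewrite !oct_conj_inv axial_beZ => /eqP.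
rewrite -subr_eq0 -scalerBl scaler_eq0 axial_be_eq0 (negPf x0) orbF subr_eq0.
by move/eqP/invr_inj.
Qed.

Lemma axial_hyperbolic_plane x y :
  hyperbolic_plane R (x, y) -> hyperbolic_plane R (al x, be y).
Proof. by rewrite !hyperbolic_planeE axial_al_norm axial_be_norm. Qed.

Lemma axial_al_den c s x : al (boost_den c s x) = boost_den c s (al x).
Proof. by rewrite axial_alD axial_alZ axial_al_real. Qed.

(** The partial fraction form involves only operations with which [al] is known to commute: sums,
    real multiples and inverses. *)
Lemma axial_al_mobius c s x : c ^+ 2 - s ^+ 2 = 1 ->
  al (mobius c s x) = mobius c s (al x).
Proof.
(* [mobiusE] divides by [s]; for [s = 0] the denominator is the real [c]. *)
move=> cs; have [->|s0] := eqVneq s 0.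
  rewrite /mobius /boost_num /boost_den /(oct_real 0) !scale0r !add0r !addr0.
  by rewrite oct_inv_real !oct_mul_realr !axial_alZ.
have [d0|d0] := eqVneq (boost_den c s x) 0.
  by rewrite /mobius -axial_al_den d0 al0 oct_inv0 !oct_mul0r al0.
rewrite !mobiusE -?axial_al_den ?axial_al_eq0 // -!scaleN1r.
by rewrite axial_alD axial_al_real !(axial_alZ (-1)) (axial_alZ s^-1)
  axial_al_inv.
Qed.

Lemma axial_a_formula t x y :
  g (a_formula t x y) = a_formula t (al x) (be y).
Proof.
rewrite /a_formula gA axial_beM axial_al_inv; congr (Affine _ (_ *o oct_inv _)).
  exact: axial_al_mobius (cosh2_sinh2 t).
exact: axial_al_den.
Qed.

End AxialTheory.

End AxialCollineations.

(** * The boost at [t = ln 2] and the equality of the two groups *)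

Lemma sinh_ln2 (R : realType) : sinh (ln 2 : R) = 3 / 4.
Proof. by rewrite /sinh expRN lnK ?posrE //; field. Qed.

Lemma cosh_ln2 (R : realType) : cosh (ln 2 : R) = 5 / 4.
Proof. by rewrite /cosh expRN lnK ?posrE //; field. Qed.

Theorem proposition4p5 (R : realType) :
  group_M R = stabilizer (group_K R) (Affine (oct_real 1) 0).
Proof.
have [s0 t0] : (3 / 4 != 0 :> R) /\ (3 / 5 != 0 :> R).
  by split; rewrite mulf_neq0 // ?invr_eq0 pnatr_eq0.
apply/seteqP; split=> g [Kg].
  (* At [t = ln 2] the values of [sinh] and [cosh] are rational, so the origin moves to the rational
     point (3/5, 0). *)
  set s : R := 3 / 4; set c : R := 5 / 4.
  have aA : is_a (ln 2) (boost c s).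
    by rewrite /c /s -sinh_ln2 -cosh_ln2; apply: boost_is_a; rewrite sinh_ln2.
  have /[swap]/[apply] : group_A R (boost c s) by exists (ln 2).
  have a0 : boost c s (Affine 0 0) = Affine (oct_real (3 / 5)) 0.
    rewrite (aA.2 0 0); last by apply/hyperbolic_planeE; rewrite oct_norm0 addr0.
    rewrite /a_formula !scaler0 !add0r oct_mul0l oct_inv_real oct_mul_realr.
    by rewrite -oct_realM sinh_ln2 cosh_ln2; congr (Affine (oct_real _) _); field.
  move=> comm.
  have gr : g (Affine (oct_real (3 / 5)) 0) = Affine (oct_real (3 / 5)) 0.
    by rewrite -a0 -[LHS]/((g \o boost c s) (Affine 0 0)) comm /comp Kg.2.
  have r0 : oct_real (3 / 5 : R) != 0 by rewrite oct_real_eq0.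
  have [al [be [ga gE]]] := axial_stabilizer Kg r0 gr.
  have gI := bij_inj Kg.1.1.1.
  have [gA _ al0 be0 _] := gE.
  split=> //; rewrite gA be0; congr Affine.
  have : al (oct_real (3 / 5)) = oct_real (3 / 5) by move: gr; rewrite gA => -[].
  (* Since [3 * 1 = 5 * (3/5)], additivity alone passes from [3/5] to 1. *)
  have e3 : oct_real (1 : R) *+ 3 = oct_real (3 / 5) *+ 5.
    by apply/rowP => i; rewrite !mulmxnE !mxE; field.
  move=> /(congr1 (fun x => x *+ 5)); rewrite -(axial_alMn gI gE) -e3.
  have n3 : 3 != 0 :> R by rewrite pnatr_eq0.
  by rewrite (axial_alMn gI gE) -!scaler_nat => /(scalerI n3).
move=> g1; split=> // a [t [[ca pa] aE]].
have r0 : oct_real (1 : R) != 0 by rewrite oct_real_eq0 oner_eq0.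
have [al [be [ga gE]]] := axial_stabilizer Kg r0 g1.
have gI := bij_inj Kg.1.1.1; have pg := Kg.1.2.
have [gA _ _ _ _] := gE.
have al1 : al (oct_real 1) = oct_real 1 by move: g1; rewrite gA => -[].
apply: agree_on_hyperbolic_plane => [||x y xy].
- exact: collineation_comp Kg.1.1 ca.
- exact: collineation_comp ca Kg.1.1.
(* The formula for [a] must be applied at the image point as well, so that point has to lie in the
   ball. *)
have xy' := axial_hyperbolic_plane gI gE al1 pg xy.
by rewrite /comp gA !aE // (axial_a_formula gI gE al1 pg).
Qed.
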